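(* Let $\tilde L=U\Lambda U^\top$ be an eigendecomposition of the normalized Laplacian of an undirected graph on $n$ nodes, with $U$ orthogonal and $\Lambda=\mathrm{diag}(\lambda_1,\dots,\lambda_n)$, and assume that $\lambda_1,\dots,\lambda_n$ are pairwise distinct. Let $H\in\mathbb{R}^{n\times n\times d}$ be a $d$-channel node-pair representation with channels $H^{(1)},\dots,H^{(d)}\in\mathbb{R}^{n\times n}$, and assume that for every $1\le i,j\le n$ there exists at least one channel $c\in\{1,\dots,d\}$ with $(U^\top H^{(c)}U)_{ij}\neq 0$. Then for every target $Y\in\mathbb{R}^{n\times n}$ there exist $W\in\mathbb{R}^{d\times 1}$ and a bivariate function $g:\mathbb{R}^2\to\mathbb{R}$ such that $\mathcal T_{g,W}(H)=Y$, where $\mathcal T_{g,W}$ is the linear FSpecGNN defined by $g$ and $W$.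
   Context: The normalized Laplacian is $\tilde L=I-D^{-1/2}AD^{-1/2}$, with $A$ the adjacency matrix and $D$ the degree matrix. Matrices in $\mathbb{R}^{n\times n}$ are identified with vectors in $\mathbb{R}^{n^2}$ by column-stacking, so $H\in\mathbb{R}^{n\times n\times d}\cong\mathbb{R}^{n^2\times d}$. For $g:\mathbb{R}^2\to\mathbb{R}$ let $(G_\lambda)_{ij}=g(\lambda_i,\lambda_j)$. The linear FSpecGNN (no nonlinear activation) with one-dimensional output is $$\mathcal T_{g,W}(H):=(U\otimes U)\Bigl(G_\lambda\odot\bigl((U\otimes U)^\top H\bigr)\Bigr)W,$$ where $\odot$ is the entrywise product, applied to each channel. Equivalently, with $W=(w_1,\dots,w_d)^\top$, $$\mathcal T_{g,W}(H)=U\Bigl(G_\lambda\odot\bigl(U^\top\bigl(\textstyle\sum_{c=1}^d w_cH^{(c)}\bigr)U\bigr)\Bigr)U^\top\in\mathbb{R}^{n\times n}.$$ *)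

(* Defs.v *)
From HB Require Import structures.
From mathcomp Require Import all_boot all_order all_algebra.
From mathcomp Require Import reals.
From mathcomp Require Import mxtens.

Set Implicit Arguments.
Unset Strict Implicit.
Unset Printing Implicit Defensive.

Import Order.TTheory GRing.Theory Num.Theory.
Local Open Scope ring_scope.

Section NormalizedLaplacian.
Variables (R : realType) (n : nat) (e : rel 'I_n).

Definition adjmx : 'M[R]_n := \matrix_(i, j) (e i j)%:R.

Definition deg (i : 'I_n) : nat := #|[set j | e i j]|.

Definition degmx : 'M[R]_n := diag_mx (\row_i (deg i)%:R).

(* Since 0^-1 = 0, an isolated vertex gets the entry 0 in D^(-1/2). *)
Definition degmx_invsqrt : 'M[R]_n :=
  diag_mx (\row_i (Num.sqrt (degmx i i))^-1).

Definition normalized_laplacian : 'M[R]_n :=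
  1%:M - degmx_invsqrt *m adjmx *m degmx_invsqrt.

End NormalizedLaplacian.

Section FSpecGNN.
Variables (R : realType) (n : nat).

(* Column stacking: X i j sits at position j * n + i.  The pair indexing is the
   one of the Kronecker product *t, so that (A *t B) vec(X) = vec(B X A^T).
   The library's mxvec stacks rows and uses another indexing. *)
Definition vec (X : 'M[R]_n) : 'cV[R]_(n * n) :=
  \col_k X (mxtens_unindex k).2 (mxtens_unindex k).1.

Definition unvec (v : 'cV[R]_(n * n)) : 'M[R]_n :=
  \matrix_(i, j) v (mxtens_index (j, i)) 0.

Lemma vecK : cancel vec unvec.
Proof. by move=> X; apply/matrixP=> i j; rewrite !mxE mxtens_indexK. Qed.

Lemma unvecK : cancel unvec vec.
Proof.
move=> v; apply/colP=> k; rewrite !mxE.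
by rewrite -surjective_pairing mxtens_unindexK.
Qed.

Definition stack_channels d (H : 'I_d -> 'M[R]_n) : 'M[R]_(n * n, d) :=
  \matrix_(k, c) vec (H c) k 0.

Definition Gmx (g : R -> R -> R) (lam : 'rV[R]_n) : 'M[R]_n :=
  \matrix_(i, j) g (lam 0 i) (lam 0 j).

Definition hadamard_channels d (v : 'cV[R]_(n * n)) (M : 'M[R]_(n * n, d)) :
    'M[R]_(n * n, d) :=
  \matrix_(k, c) (v k 0 * M k c).

Definition fspecgnn d (U : 'M[R]_n) (lam : 'rV[R]_n) (g : R -> R -> R)
    (W : 'cV[R]_d) (H : 'I_d -> 'M[R]_n) : 'M[R]_n :=
  unvec ((U *t U) *m
    hadamard_channels (vec (Gmx g lam)) ((U *t U)^T *m stack_channels H) *m W).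

Lemma tens_vec (A B X : 'M[R]_n) : (A *t B) *m vec X = vec (B *m X *m A^T).
Proof.
apply/colP=> k; rewrite !mxE.
under [RHS]eq_bigr => j _ do rewrite !mxE big_distrl.
rewrite pair_bigA (reindex (@mxtens_index n n)) /=; last first.
  by exists (@mxtens_unindex n n) => i _; rewrite (mxtens_indexK, mxtens_unindexK).
apply: eq_bigr => -[j i] _ /=; rewrite !mxE mxtens_indexK /=.
by rewrite [RHS]mulrC mulrA.
Qed.

Lemma fspecgnnE d (U : 'M[R]_n) (lam : 'rV[R]_n) (g : R -> R -> R)
    (W : 'cV[R]_d) (H : 'I_d -> 'M[R]_n) :
  fspecgnn U lam g W H =
  U *m map2_mx *%R (Gmx g lam) (U^T *m (\sum_c W c 0 *: H c) *m U) *m U^T.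
Proof.
have stackW : stack_channels H *m W = vec (\sum_c W c 0 *: H c).
  apply/colP=> k; rewrite !mxE summxE; apply: eq_bigr=> c _.
  by rewrite !mxE mulrC.
have hadW v (M : 'M[R]_(n * n, d)) :
    hadamard_channels v M *m W = map2_mx *%R v (M *m W).
  apply/colP=> k; rewrite !mxE big_distrr; apply: eq_bigr=> c _ /=.
  by rewrite !mxE mulrA.
rewrite /fspecgnn -mulmxA hadW -(mulmxA _ _ W) stackW trmx_tens tens_vec trmxK.
have -> A B : map2_mx *%R (vec A) (vec B) = vec (map2_mx *%R A B).
  by apply/colP=> k; rewrite !mxE.
by rewrite tens_vec vecK.
Qed.

End FSpecGNN.

(* Main.v *)
(* Write M for the spectral transform U^T (sum_c w_c H^(c)) U.  Each entry of M
   is a nonzero linear form in the weights, and along the moment curve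
   w_c = t^c it becomes a nonzero polynomial in t; some t avoids the roots of
   all these polynomials.  As M then has no zero entry and the eigenvalues are
   distinct, g may be interpolated freely so that the filtered transform equals
   U^T Y U. *)
Require Import Defs.
From HB Require Import structures.
From mathcomp Require Import all_boot all_order all_algebra.
From mathcomp Require Import reals.

Set Implicit Arguments.
Unset Strict Implicit.
Unset Printing Implicit Defensive.

Import Order.TTheory GRing.Theory Num.Theory.
Local Open Scope ring_scope.

(** The naturals below [size p] stay distinct in [R], by characteristic zero, and are one more than
    the degree of [p] allows as roots. *)
Lemma poly_nonroot (R : numDomainType) (p : {poly R}) :
  p != 0 -> exists x, p.[x] != 0.
Proof.
move=> p_neq0; pose s : seq R := [seq k%:R | k <- iota 0 (size p)].
have s_uniq : uniq s.
  by rewrite map_inj_uniq ?iota_uniq // => k l /eqP; rewrite eqr_nat => /eqP.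
have : ~~ all (root p) s.
  apply/negP=> /(max_poly_roots p_neq0)/(_ s_uniq).
  by rewrite size_map size_iota ltnn.
by case/allPn=> x _ px_neq0; exists x.
Qed.

Lemma weights_nonvanishing (R : numDomainType) (I : finType) (d : nat)
    (a : I -> 'I_d -> R) :
  (forall i, exists c, a i c != 0) ->
  exists w : 'I_d -> R, forall i, \sum_c w c * a i c != 0.
Proof.
move=> a_neq0; pose p i : {poly R} := \sum_c a i c *: 'X^c.
have p_neq0 i : p i != 0.
  have [c] := a_neq0 i; apply: contra_neq => pi0.
  (* Distinct channels carry distinct exponents, so the coefficient of [p i] at ['X^c] is exactly
     [a i c]. *)
  have := coef0 R c; rewrite -pi0 coef_sum (bigD1 c) //= big1 => [|k kc].
    by rewrite coefZ coefXn eqxx mulr1 addr0.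
  by rewrite coefZ coefXn eq_sym (inj_eq val_inj) (negPf kc) mulr0.
(* A nonroot of the finite product is a common nonroot of all the [p i]. *)
have [|t] := @poly_nonroot R (\prod_i p i).
  by apply/prodf_neq0=> i _; apply: p_neq0.
rewrite horner_prod => /prodf_neq0 pt_neq0.
exists (fun c => t ^+ c) => i; have := pt_neq0 i isT.
rewrite horner_sum; congr (_ != 0); apply: eq_bigr=> c _.
by rewrite hornerZ hornerXn mulrC.
Qed.

(** Injectivity lets a node be decoded back to its index; [y0] is only the value away from the
    nodes. *)
Lemma interpolation2 (I : finType) (T : eqType) (S : Type) (y0 : S)
    (x : I -> T) (y : I -> I -> S) :
  injective x -> exists g : T -> T -> S, forall i j, g (x i) (x j) = y i j.
Proof.
move=> x_inj; pose x' u := [pick i | x i == u].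
have xK i : x' (x i) = Some i.
  by rewrite /x'; case: pickP => [k /eqP/x_inj-> | /(_ i)/eqP].
exists (fun u v => if (x' u, x' v) is (Some i, Some j) then y i j else y0).
by move=> i j; rewrite !xK.
Qed.

Theorem theorem3p4 (R : realType) (n d : nat) (e : rel 'I_n)
    (e_sym : symmetric e)
    (U : 'M[R]_n) (lam : 'rV[R]_n)
    (U_orth : U^T *m U = 1%:M)
    (L_eigendec : normalized_laplacian R e = U *m diag_mx lam *m U^T)
    (lam_distinct : forall i j : 'I_n, i != j -> lam 0 i != lam 0 j)
    (H : 'I_d -> 'M[R]_n)
    (H_nonzero : forall i j : 'I_n, exists c : 'I_d,
       (U^T *m H c *m U) i j != 0)
    (Y : 'M[R]_n) :
  exists (W : 'cV[R]_d) (g : R -> R -> R), fspecgnn U lam g W H = Y.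
Proof.
have lam_inj : injective (lam 0).
  by move=> i j; apply: contra_eq; apply: lam_distinct.
have [w w_neq0] := @weights_nonvanishing R ('I_n * 'I_n)%type d
  (fun ij c => (U^T *m H c *m U) ij.1 ij.2) (fun ij => H_nonzero ij.1 ij.2).
pose M := U^T *m (\sum_c w c *: H c) *m U.
have M_neq0 i j : M i j != 0.
  suff -> : M i j = \sum_c w c * (U^T *m H c *m U) i j by apply: w_neq0 (i, j).
  rewrite /M mulmx_sumr mulmx_suml summxE; apply: eq_bigr=> c _.
  by rewrite -scalemxAr -scalemxAl mxE.
(* The entrywise quotient makes the filter turn [M] into [U^T *m Y *m U]; off the spectrum [g] is
   0. *)
have [g gE] :=
  interpolation2 0 (fun i j => (U^T *m Y *m U) i j / M i j) lam_inj.
exists (\col_c w c), g; rewrite fspecgnnE.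
under eq_bigr => c _ do rewrite mxE.
have -> : map2_mx *%R (Gmx g lam) M = U^T *m Y *m U.
  by apply/matrixP=> i j; rewrite mxE [Gmx _ _ _ _]mxE gE divfK.
have UUT : U *m U^T = 1%:M by apply: mulmx1C.
by rewrite !mulmxA UUT mul1mx -mulmxA UUT mulmx1.
Qed.
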